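(* Let $\lambda_B>0$, let $k\ge1$ be an integer, and let the $B$-points form a one-dimensional homogeneous Poisson process on $\mathbb{R}$ with intensity $\lambda_B$, with points $(B_i)_{i\in\mathbb{Z}}$ in increasing order. Then for every point $i$, the $k$-th order area $X_k(i)$ is equal in distribution to $\frac12 D_1+\frac12 D_2$, where $D_1$ and $D_2$ are independent and identically distributed exponential random variables with parameter (rate) $\lambda_B$.
   Context: The points are indexed so that the spacings $B_i-B_{i-1}$, $i\in\mathbb{Z}$, are i.i.d. exponential random variables with rate $\lambda_B$ (i.e. $B_i$ with fixed index $i$ is a typical point of the Poisson process). The $k$-th order area $X_k(i)$ of point $i$ is the Lebesgue measure (total length) of the set of locations $x\in\mathbb{R}$ such that $B_i$ is the $k$-th point when all the $B$-points are sorted by increasing distance to $x$. Locations equidistant from two $B$-points form a null set and can be ignored. *)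

(* Defs.v *)
From HB Require Import structures.
From mathcomp Require Import all_boot all_order all_algebra finmap.
From mathcomp Require Import all_classical all_reals all_analysis.
From mathcomp Require Import measurable_realfun.

Set Implicit Arguments.
Unset Strict Implicit.
Unset Printing Implicit Defensive.

Import Order.TTheory GRing.Theory Num.Theory.

Local Open Scope classical_set_scope.
Local Open Scope ring_scope.

Definition mutually_independent d (T : measurableType d) (R : realType)
    (P : probability T R) (I : choiceType) (X : I -> {RV P >-> R}) : Prop :=
  forall (J : {fset I}) (A : I -> set R),
    (forall i, measurable (A i)) ->
    P (\bigcap_(i in [set` J]) X i @^-1` A i) =
    (\prod_(i <- J) P (X i @^-1` A i))%E.

(* [exponential_prob rate] has density x |-> rate * expR (- rate * x) on
   [0, +oo[, so the parameter is the rate and not the mean. *)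
Definition iid_exponential d (T : measurableType d) (R : realType)
    (P : probability T R) (rate : R) (I : choiceType)
    (X : I -> {RV P >-> R}) : Prop :=
  mutually_independent X /\
  forall (i : I) (A : set R), measurable A ->
    distribution P (X i) A = exponential_prob rate A.

(* The Poisson process of intensity [rate] seen from a typical point: this is
   the labelling for which all the spacings, including the one that straddles
   the origin, are i.i.d. exponential.  The law of [B 0] is left free.
   Exponential spacings are almost surely positive, so i |-> B i is almost
   surely increasing without a separate clause. *)
Definition poisson_points d (T : measurableType d) (R : realType)
    (P : probability T R) (rate : R) (B : int -> {RV P >-> R}) : Prop :=
  iid_exponential rate (fun i : int => B i \- B (i - 1) : {RV P >-> R}).

(* [s] lists all the indices by increasing distance of [b] to [x], the nearest
   point being [s 0].  The comparison is strict, so there is no such [s] when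
   [x] is equidistant from two points. *)
Definition distance_order (R : realType) (b : int -> R) (x : R)
    (s : nat -> int) : Prop :=
  bijective s /\ {homo s : m n / (m < n)%N >-> `|b m - x| < `|b n - x|}.

(* Ranks are counted from 1, hence the predecessor. *)
Definition order_region (R : realType) (b : int -> R) (k : nat) (i : int)
    : set R :=
  [set x | exists s : nat -> int, distance_order b x s /\ s k.-1 = i].

Definition order_area d (T : measurableType d) (R : realType)
    (P : probability T R) (B : int -> {RV P >-> R}) (k : nat) (i : int)
    : T -> \bar R :=
  fun w => lebesgue_measure (order_region (fun j => B j w) k i).

Definition eq_in_distribution d1 d2 d (T1 : measurableType d1)
    (T2 : measurableType d2) (U : measurableType d) (R : realType)
    (P1 : probability T1 R) (P2 : probability T2 R)
    (X : T1 -> U) (Y : T2 -> U) : Prop :=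
  [/\ measurable_fun [set: T1] X, measurable_fun [set: T2] Y &
      forall A : set U, measurable A ->
        pushforward P1 X A = pushforward P2 Y A].

(* Main.v *)
Require Import Defs.
From HB Require Import structures.
From mathcomp Require Import all_boot all_order all_algebra finmap.
From mathcomp Require Import all_classical all_reals all_analysis.
From mathcomp Require Import measurable_realfun.
From mathcomp Require Import zify lra.

Set Implicit Arguments.
Unset Strict Implicit.
Unset Printing Implicit Defensive.

Import Order.TTheory GRing.Theory Num.Theory.

Local Open Scope classical_set_scope.
Local Open Scope ring_scope.

(** The whole theorem rests on a geometric identity for a fixed configuration
[b] that is increasing and unbounded on both sides.  To the right of [b i],
the points strictly closer to [x] than [b i] are those in the open interval
from [b i] to its mirror image [2 x - b i]; exactly [n] of them lie there when
the mirror image falls between [b (i + n)] and [b (i + n + 1)], that is, when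
[x] lies between the midpoint of [b i] and [b (i + n)] and the midpoint of
[b i] and [b (i + n + 1)].  The length of this interval is half the spacing
that ends at [b (i + n + 1)].  By reflection the left side contributes half
the spacing that ends at [b (i - n)].  With [n = k - 1] the area is therefore
half the sum of two spacings, whatever the other points are; the two spacings
have distinct indices, so they are independent exponential variables
([rank_right], [rank_left], [lebesgue_order_region]).

Probability enters twice.  Exponential spacings are almost surely positive,
and infinitely many of them exceed 1 on each side, so that almost every
configuration satisfies the geometric hypotheses
([poisson_points_increasing_unbounded]).  And the law of a function of two
independent variables with common law [mu] is determined by [mu], through the
uniqueness of the product measure ([pair_law]).

Equality in distribution also requires the area to be measurable on the whole
sample space, including the null set of degenerate configurations, where the
geometric description fails.  For an arbitrary configuration, an enumeration
of the points by increasing distance to [x] that puts [i] in position [n]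
exists if and only if the distances are pairwise distinct, every point has
finitely many points closer to [x], and exactly [n] points are closer than
[b i] ([enumerationP]).  These are countable combinations of measurable
conditions on the pair of the outcome and [x], so that the area is the measure
of a section of a measurable set ([measurable_order_area]). *)

(** * Enumerating the integers by increasing values of a function *)

(** The finite set of smaller elements is given by a duplicate-free sequence,
which makes its finiteness part of the definition and lets it range over a
countable type. *)
Definition has_rank (R : realType) (f : int -> R) (i : int) (n : nat) : Prop :=
  exists J : seq int,
    [/\ uniq J, size J = n & forall m, (m \in J) = (f m < f i)].

Section Rank.
Variables (R : realType) (f : int -> R).

Lemma has_rank_uniq i m n : has_rank f i m -> has_rank f i n -> m = n.
Proof.
move=> [J [uJ <- JE]] [K [uK <- KE]].
by apply/perm_size/uniq_perm => // x; rewrite JE KE.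
Qed.

Lemma has_rank_lt i j m n :
  has_rank f i m -> has_rank f j n -> f i < f j -> (m < n)%N.
Proof.
move=> [J [uJ <- JE]] [K [uK <- KE]] fij.
apply: (@uniq_leq_size _ (i :: J)) => [|x]; first by rewrite /= JE ltxx.
by rewrite inE KE => /predU1P[->//|]; rewrite JE => /lt_trans; apply.
Qed.

Lemma seq_argmax (J : seq int) : J != [::] ->
  exists2 l, l \in J & forall m, m \in J -> f m <= f l.
Proof.
elim: J => // a [|c J] IH _.
  by exists a => [|m]; rewrite inE // => /eqP ->.
have [//|l lJ lmax] := IH; have [fal|fla] := leP (f a) (f l).
  by exists l => [|m]; rewrite inE ?lJ ?orbT // => /predU1P[->//|/lmax].
exists a => [|m]; rewrite inE ?eqxx // => /predU1P[->//|/lmax fml].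
exact: le_trans fml (ltW fla).
Qed.

(** Among the elements below [j], the one with the largest value has all the
others below it. *)
Lemma has_rank_pred j n : injective f ->
  has_rank f j n.+1 -> exists l, has_rank f l n.
Proof.
move=> finj [J [uJ sJ JE]].
have [|l lJ lmax] := @seq_argmax J; first by case: J sJ {uJ JE}.
exists l, (rem l J); split; [exact: rem_uniq|by rewrite size_rem // sJ|].
move=> m; rewrite mem_rem_uniq // inE.
have [->|ml] := eqVneq m l; first by rewrite ltxx.
rewrite lt_neqAle (inj_eq finj) ml /=; apply/idP/idP => [|fml]; first exact: lmax.
by rewrite JE; apply: le_lt_trans fml _; rewrite -JE.
Qed.

(** This trades an existential over the uncountable type [nat -> int] for
conditions on finite sequences of indices.  For the converse, when all ranks
exist, the rank function is injective, hence unbounded, and by [has_rank_pred] its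
image is closed under predecessors; it is thus a bijection onto [nat], and [s]
is its inverse. *)
Lemma enumerationP i n :
  (exists s : nat -> int,
     (bijective s /\ {homo s : m n / (m < n)%N >-> f m < f n}) /\ s n = i) <->
  [/\ injective f, forall j, exists p, has_rank f j p & has_rank f i n].
Proof.
split=> [[s [[[t st ts] smono] sn]]|[finj ranked rin]].
  have sE a c : (f (s a) < f (s c)) = (a < c)%N.
    case: (ltngtP a c) => [/smono //|/smono ca|->]; last exact: ltxx.
    by apply/negbTE; rewrite -leNgt ltW.
  have rank_s p : has_rank f (s p) p.
    exists (map s (iota 0 p)); split; last 1 first.
    - move=> m; rewrite -{2}(ts m) sE -{1}(ts m).
      by rewrite (mem_map (can_inj st)) mem_iota.
    - by rewrite (map_inj_uniq (can_inj st)) iota_uniq.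
    - by rewrite size_map size_iota.
  split=> [j l fjl|j|]; last by rewrite -sn.
    rewrite -(ts j) -(ts l); congr s.
    by case: (ltngtP (t j) (t l)) => // /smono; rewrite !ts fjl ltxx.
  by exists (t j); rewrite -{1}(ts j).
have [t tP] := choice ranked.
have tinj : injective t.
  move=> j l tjl; case: (ltgtP (f j) (f l)) => [||/finj//] /has_rank_lt fjl.
    by have := fjl _ _ (tP j) (tP l); rewrite tjl ltnn.
  by have := fjl _ _ (tP l) (tP j); rewrite tjl ltnn.
(* Otherwise [t] would map [p + 1] distinct indices into [0, p - 1]. *)
have tlarge p : exists j, (p <= t j)%N.
  apply: contrapT => /forallNP tp.
  have := @uniq_leq_size _ (map t (map Posz (iota 0 p.+1))) (iota 0 p).
  rewrite (map_inj_uniq tinj) map_inj_uniq ?iota_uniq; last by move=> ? ? [].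
  rewrite !size_map !size_iota ltnn => /(_ isT) sub.
  suff /sub : {subset map t (map Posz (iota 0 p.+1)) <= iota 0 p} by [].
  move=> _ /mapP[j _ ->].
  by rewrite mem_iota ltnNge; apply/negP/tp.
have tsurj p : exists j, t j = p.
  suff descend q j : has_rank f j (q + p) -> exists l, has_rank f l p.
    have [j /subnK tj] := tlarge p.
    have [l rl] := descend (t j - p)%N j (ltac:(by rewrite tj)).
    by exists l; apply: has_rank_uniq (tP l) rl.
  elim: q j => [j rj|q IH j]; first by exists j.
  by rewrite addSn => /(has_rank_pred finj)[l /IH].
have [s sK] := choice tsurj.
exists s; split; last by apply: tinj; rewrite sK; exact: has_rank_uniq rin (tP i).
split; first by exists t => // j; apply: tinj.
move=> m p mp; rewrite ltNge le_eqVlt; apply/negP => /predU1P[/finj spm|spm].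
  by move: mp; rewrite -(sK m) -(sK p) spm ltnn.
by have := has_rank_lt (tP _) (tP _) spm; rewrite !sK ltnNge (ltnW mp).
Qed.

End Rank.

(** * Ranks of the distances to a location *)

Lemma has_rank_opp (R : realType) (f : int -> R) i n :
  has_rank f i n -> has_rank (fun m => f (- m)) (- i) n.
Proof.
move=> [J [uJ sJ JE]]; exists (map -%R J).
split; [by rewrite (map_inj_uniq oppr_inj)|by rewrite size_map|move=> m].
by rewrite -{1}(opprK m) (mem_map oppr_inj) JE opprK.
Qed.

(** Equal indices are allowed, so that the points themselves are ties; this
only enlarges a null set, and it keeps [x = b i] out of the case analyses. *)
Definition tie (R : realType) (b : int -> R) : set R :=
  range (fun p : int * int => (b p.1 + b p.2) / 2).

Definition increasing_unbounded (R : realType) (b : int -> R) : Prop :=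
  [/\ {homo b : m n / m < n}, forall M, exists j, M < b j &
      forall M, exists j, b j < M].

Section Geometry.
Variable R : realType.
Implicit Types (b : int -> R) (x : R) (i : int) (n : nat).

Lemma increasing_unbounded_opp b :
  increasing_unbounded b -> increasing_unbounded (fun m => - b (- m)).
Proof.
move=> [binc bup bdown]; split=> [m n mn|M|M].
- by rewrite ltrN2 binc // ltrN2.
- by have [j bj] := bdown (- M); exists (- j); rewrite opprK ltrNr.
- by have [j bj] := bup (- M); exists (- j); rewrite opprK ltrNl.
Qed.

Lemma tie_opp b x : tie (fun m => - b (- m)) x -> tie b (- x).
Proof. by move=> [[m n] _ /= <-]; exists (- m, - n) => //=; lra. Qed.

Lemma straddle b i (y : R) : increasing_unbounded b -> b i <= y ->
  exists n : nat, b (i + n%:Z) <= y < b (i + n.+1%:Z).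
Proof.
move=> [binc bup _] biy.
have bmono : {mono b : m n / m <= n} by apply: le_mono.
have ex : exists p : nat, y < b (i + p%:Z).
  have [j yj] := bup y; exists (absz (j - i)%R).
  have /ltW : i < j by rewrite -(leW_mono bmono) (le_lt_trans biy).
  by move=> ij; suff -> : i + (absz (j - i)%R)%:Z = j by []; lia.
(* The first point beyond [y] is not [b i], so it has a predecessor. *)
case: (ex_minnP ex) => -[|p] yp pmin; first by move: yp; rewrite addr0 ltNge biy.
exists p; rewrite yp andbT leNgt; apply/negP => /pmin; lia.
Qed.

(** The points closer to [x] than [b i] are the points between [b i] and its
mirror image [2 * x - b i].  This gives the backward direction; the forward
one follows because the mirror image always falls in some cell of the
configuration, and the rank is unique. *)
Lemma rank_right b i x n : increasing_unbounded b -> b i < x -> ~ tie b x ->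
  has_rank (fun m => `|b m - x|) i n <->
  b i + b (i + n%:Z) < 2 * x < b i + b (i + n.+1%:Z).
Proof.
move=> lb bix ntie; have [binc _ _] := lb.
have bmono : {mono b : m n / m <= n} by apply: le_mono.
have between p : b i + b (i + p%:Z) < 2 * x < b i + b (i + p.+1%:Z) ->
    has_rank (fun m => `|b m - x|) i p.
  move=> /andP[px xp]; exists [seq i + 1 + q%:Z | q <- iota 0 p].
  split; [|by rewrite size_map size_iota|move=> m].
    by rewrite map_inj_uniq ?iota_uniq // => ? ? /addrI[].
  have -> : (`|b m - x| < `|b i - x|) = (i < m <= i + p%:Z).
    rewrite (ltr0_norm (_ : b i - x < 0)) ?subr_lt0 // ltr_distl.
    rewrite -(leW_mono bmono); congr andb; first by congr (_ < _); lra.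
    apply/idP/idP => [mx|]; last by rewrite -bmono => mp; lra.
    suff : m < i + p.+1%:Z by lia.
    by rewrite -(leW_mono bmono); lra.
  apply/mapP/idP => [[q]|/andP[im mp]]; first by rewrite mem_iota => qp ->; lia.
  by exists (absz (m - (i + 1))%R); rewrite ?mem_iota; lia.
split=> [rin|]; last exact: between.
have [|p /andP[px xp]] := @straddle b i (2 * x - b i) lb; first lra.
have cell : b i + b (i + p%:Z) < 2 * x < b i + b (i + p.+1%:Z).
  apply/andP; split; last lra.
  rewrite lt_neqAle; apply/andP; split; last lra.
  by apply/eqP => e; apply: ntie; exists (i, i + p%:Z) => //=; lra.
by rewrite (has_rank_uniq rin (between p cell)).
Qed.

(** The reflection [m |-> - b (- m)] exchanges the two sides of [b i]. *)
Lemma rank_left b i x n : increasing_unbounded b -> x < b i -> ~ tie b x ->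
  has_rank (fun m => `|b m - x|) i n <->
  b i + b (i - n.+1%:Z) < 2 * x < b i + b (i - n%:Z).
Proof.
move=> lb xbi ntie.
have lbN := increasing_unbounded_opp lb.
have := @rank_right (fun m => - b (- m)) (- i) (- x) n lbN.
rewrite opprK ltrN2 => /(_ xbi)[].
  by move/tie_opp; rewrite opprK.
move=> /=; rewrite !opprD !opprK => h1 h2.
(* The distances of the reflected points to [- x]. *)
have distN : (fun m => `|- b (- m) + x|) = (fun m => `|b (- m) - x|).
  by apply/funext => m; rewrite addrC distrC.
rewrite distN in h1 h2; split=> [/has_rank_opp/h1|xb]; first lra.
have /has_rank_opp := h2 (ltac:(lra)).
by rewrite opprK; under eq_fun do rewrite opprK.
Qed.

Lemma order_regionP b (k : nat) i x : order_region b k i x <->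
  [/\ injective (fun m => `|b m - x|),
      forall j, exists p, has_rank (fun m => `|b m - x|) j p &
      has_rank (fun m => `|b m - x|) i k.-1].
Proof. exact: (enumerationP (fun m => `|b m - x|)). Qed.

(** Off the ties the distances are pairwise distinct, and since the
configuration is unbounded on both sides every point has a rank. *)
Lemma order_region_rank b (k : nat) i x : increasing_unbounded b -> ~ tie b x ->
  order_region b k i x <-> has_rank (fun m => `|b m - x|) i k.-1.
Proof.
move=> lb ntie; have [binc bup bdown] := lb.
rewrite order_regionP; split=> [[]//|rin]; split=> // [m n /eqP|j].
  rewrite eqr_norm2 => /orP[/eqP/addIr|/eqP e].
    exact: (inc_inj (le_mono binc)).
  by case: ntie; exists (m, n) => //=; lra.
have ntj : b j != x by apply/eqP => e; apply: ntie; exists (j, j) => //=; lra.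
have [jx|xj|/eqP] := ltgtP (b j) x; last by rewrite (negbTE ntj).
  have [|p /andP[px xp]] := @straddle b j (2 * x - b j) lb; first lra.
  exists p; apply/rank_right => //; apply/andP; split; last lra.
  rewrite lt_neqAle; apply/andP; split; last lra.
  by apply/eqP => e; apply: ntie; exists (j, j + p%:Z) => //=; lra.
have lbN := increasing_unbounded_opp lb.
have := @straddle (fun m => - b (- m)) (- j) (b j - 2 * x) lbN.
rewrite opprK => -[|p]; first lra.
rewrite !opprD !opprK => /andP[px xp].
exists p; apply/rank_left => //; apply/andP; split; first lra.
rewrite lt_neqAle; apply/andP; split; last lra.
by apply/eqP => e; apply: ntie; exists (j, j - p%:Z) => //=; lra.
Qed.
End Geometry.

(** * The area of a fixed configuration *)

(** Off the null set of ties, the region is the union of the two disjoint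
intervals of [rank_right] and [rank_left]. *)
Lemma lebesgue_order_region (R : realType) (b : int -> R) (k : nat) (i : int) :
  increasing_unbounded b -> measurable (order_region b k.+1 i) ->
  lebesgue_measure (order_region b k.+1 i) =
  (2^-1 * (b (i + k.+1%:Z) - b (i + k%:Z)) +
   2^-1 * (b (i - k%:Z) - b (i - k.+1%:Z)))%:E.
Proof.
move=> lb mreg; have [binc _ _] := lb.
have bmono : {mono b : m n / m <= n} by apply: le_mono.
pose I1 : set R :=
  `](b i + b (i + k%:Z)) / 2, (b i + b (i + k.+1%:Z)) / 2[%classic.
pose I2 : set R :=
  `](b i + b (i - k.+1%:Z)) / 2, (b i + b (i - k%:Z)) / 2[%classic.
have b1 : b i <= b (i + k%:Z) by rewrite bmono; lia.
have b2 : b (i + k%:Z) < b (i + k.+1%:Z) by apply: binc; lia.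
have b3 : b (i - k%:Z) <= b i by rewrite bmono; lia.
have b4 : b (i - k.+1%:Z) < b (i - k%:Z) by apply: binc; lia.
have ctie : countable (tie b).
  exact: sub_countable (card_image_le _ _) (countableP _).
have mtie : measurable (tie b) by apply: countable_measurable.
have tie0 : lebesgue_measure (tie b) = 0 by apply: countable_lebesgue_measure0.
have mI1 : measurable I1 by apply: measurable_itv.
have mI2 : measurable I2 by apply: measurable_itv.
have tieU (A : set R) : measurable A ->
    lebesgue_measure (A `|` tie b) = lebesgue_measure A.
  by move=> mA; apply: measureU0.
rewrite -tieU //.
have -> : order_region b k.+1 i `|` tie b = (I1 `|` I2) `|` tie b.
  apply/seteqP; split=> x; (have [tx|ntx] := EM (tie b x); first by right).
    case=> // /(order_region_rank k.+1 i lb ntx) /= rx; left.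
    have [xi|ix|xi] := ltgtP x (b i).
    - right; have := (rank_left k lb xi ntx).1 rx.
      by rewrite /I2 /= in_itv /=; lra.
    - left; have := (rank_right k lb ix ntx).1 rx.
      by rewrite /I1 /= in_itv /=; lra.
    - by case: ntx; exists (i, i) => //=; lra.
  case=> // -[]; rewrite /I1 /I2 /= in_itv /= => Ix; left;
    apply/(order_region_rank k.+1 i lb ntx).
  - by apply/rank_right => //; lra.
  - by apply/rank_left => //; lra.
rewrite tieU; last exact: measurableU.
have -> : lebesgue_measure (I1 `|` I2) =
    (lebesgue_measure I1 + lebesgue_measure I2)%E.
  apply: measureU => //; rewrite -subset0 => x [].
  by rewrite /I1 /I2 /= !in_itv /=; lra.
rewrite /I1 /I2 !lebesgue_measure_itv /= !lte_fin.
rewrite ifT; last lra.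
rewrite ifT; last lra.
by rewrite -!EFinB -EFinD; congr EFin; lra.
Qed.

(** * Measurability of the area *)

Section Measurability.
Context d (U : measurableType d) (R : realType).

Lemma measurable_has_rank (f : int -> U -> R) (i : int) (n : nat) :
  (forall m, measurable_fun [set: U] (f m)) ->
  measurable [set u | has_rank (f^~ u) i n].
Proof.
move=> mf.
(* [J] witnesses the rank when no index [m] makes membership in [J] and the
   comparison of values disagree. *)
rewrite (_ : [set u | _] =
  \bigcup_(J : seq int) (if uniq J && (size J == n) then
    ~` \bigcup_(m : int) [set u | (f m u < f i u) = (m \notin J)] else set0)).
  apply: countable_bigcupT_measurable => [|J]; first exact: countableP.
  case: ifP => _ //.
  apply/measurableC/countable_bigcupT_measurable => [|m]; first exact: countableP.
  rewrite -[X in measurable X]setTI.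
  (* [I] proves that a set of booleans is measurable: all of them are. *)
  have mlt := measurable_fun_ltr (mf m) (mf i).
  exact: (mlt measurableT [set (m \notin J)] I).
apply/seteqP; split=> u.
  move=> [J [uJ sJ JE]]; exists J => //; rewrite uJ sJ eqxx /= => -[m _ /=].
  by rewrite -JE; case: (m \in J).
move=> [J _]; case: ifP => // /andP[uJ /eqP sJ] nJ; exists J; split=> // m.
apply/eqP; apply: contrapT => e; apply: nJ; exists m => //=.
by move: e; case: (m \in J); case: (f m u < f i u).
Qed.

End Measurability.

Section MeasurableArea.
Context d (U : measurableType d) (R : realType).

(** Through [order_regionP] the region is a countable combination of rank
conditions on the distances, which are jointly measurable in the outcome and
the location. *)
Lemma measurable_order_region (B : int -> U -> R) (k : nat) (i : int) :
  (forall j, measurable_fun [set: U] (B j)) ->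
  measurable [set p : U * R | order_region (fun j => B j p.1) k i p.2].
Proof.
move=> mB; pose f m (p : U * R) := `|B m p.1 - p.2|.
have mf m : measurable_fun [set: U * R] (f m).
  apply: measurableT_comp => //; apply: measurable_funB => //.
  exact: measurableT_comp.
rewrite (_ : [set p | _] =
  (~` (\bigcup_(mn : int * int)
         [set p | (f mn.1 p == f mn.2 p) && (mn.1 != mn.2)]) `&`
   ~` (\bigcup_(j : int) ~` (\bigcup_(n : nat) [set p | has_rank (f^~ p) j n])))
  `&` [set p | has_rank (f^~ p) i k.-1]).
  apply: measurableI; last exact: measurable_has_rank.
  apply: measurableI; apply/measurableC/countable_bigcupT_measurable => [|j];
    try exact: countableP.
    rewrite -[X in measurable X]setTI; have [->|ne] := eqVneq j.1 j.2.
      rewrite (_ : [set _ | _] = set0) ?setI0 //.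
      by apply/seteqP; split=> // x; rewrite /= andbF.
    under [X in _ `&` X]eq_set do rewrite andbT.
    have meq := measurable_fun_eqr (mf j.1) (mf j.2).
    exact: (meq measurableT [set true] I).
  by apply/measurableC/bigcupT_measurable => n; exact: measurable_has_rank.
apply/seteqP; split=> p.
  move=> /order_regionP[finj ranked ri]; split=> //; split.
    by move=> [[m n] _ /= /andP[/eqP /finj ->]]; rewrite eqxx.
  by move=> [j _]; apply; have [n rn] := ranked j; exists n.
move=> [[ninj nranked] ri]; apply/order_regionP; split=> // [m n e|j].
  apply: contrapT => /eqP mn; apply: ninj; exists (m, n) => //=.
  by rewrite mn andbT; apply/eqP.
apply: contrapT => nr; apply: nranked; exists j => // -[n _ rn].
by apply: nr; exists n.
Qed.

Lemma measurable_order_area (P : probability U R) (B : int -> {RV P >-> R})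
    (k : nat) (i : int) :
  measurable_fun [set: U] (order_area B k i).
Proof.
have mreg := measurable_order_region k i (fun j => measurable_funPT (B j)).
have := measurable_fun_xsection lebesgue_measure mreg.
congr (measurable_fun _ _); apply/funext => w /=.
rewrite /order_area /xsection /=; congr (lebesgue_measure _).
by apply/seteqP; split=> x /=; rewrite inE.
Qed.

End MeasurableArea.

(** * Independent families *)

Section Independence.
Context d (T : measurableType d) (R : realType) (P : probability T R).

Lemma independent_pair (I : choiceType) (X : I -> {RV P >-> R}) (i j : I)
    (A C : set R) : mutually_independent X -> i != j ->
  measurable A -> measurable C ->
  P ((X i @^-1` A) `&` (X j @^-1` C)) =
  (P (X i @^-1` A) * P (X j @^-1` C))%E.
Proof.
move=> indX ij mA mC; pose F l := if l == i then A else C.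
have Fi : F i = A by rewrite /F eqxx.
have Fj : F j = C by rewrite /F eq_sym (negbTE ij).
have := indX [fset i; j]%fset F (fun l => ltac:(by rewrite /F; case: ifP)).
rewrite big_fsetU1 ?inE //= big_seq_fset1 Fi Fj => <-; congr (P _).
apply/seteqP; split=> w /=.
  by move=> [wi wj] l /=; rewrite !inE => /orP[] /eqP->; rewrite ?Fi ?Fj.
by move=> wF; split; rewrite -?Fi -?Fj; apply: wF => /=; rewrite !inE eqxx ?orbT.
Qed.

(** Staying in [A] during the first [n] steps has probability [q ^+ n], which
tends to 0. *)
Lemma independent_leaves (I : choiceType) (X : I -> {RV P >-> R})
    (g : nat -> I) (A : set R) (q : R) :
  mutually_independent X -> injective g -> measurable A ->
  (forall i, P (X i @^-1` A) = q%:E) -> q < 1 ->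
  {ae P, forall w, exists n, ~ A (X (g n) w)}.
Proof.
move=> indX ginj mA PA q1.
have q0 : 0 <= q by rewrite -lee_fin -(PA (g 0%N)) measure_ge0.
have mX i : measurable (X i @^-1` A).
  by rewrite -[X in measurable X]setTI; apply: measurable_funPT.
pose E := \bigcap_(n : nat) (X (g n) @^-1` A).
have mE : measurable E by apply: bigcapT_measurable.
exists E; split=> //; last first.
  by move=> w /= nw n _; apply: contrapT => nA; apply: nw; exists n.
(* Independence is available for finite sets of indices only, so [E] is
   bounded by its first [n] conditions. *)
have PEn n : (P E <= (q ^+ n)%:E)%E.
  pose J := [fset x in map g (iota 0 n)]%fset.
  have sJ : size J = n.
    rewrite card_fseq undup_id ?size_map ?size_iota //.
    by rewrite map_inj_uniq ?iota_uniq.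
  apply: le_trans (_ : P (\bigcap_(i in [set` J]) X i @^-1` A) <= _)%E.
    apply: le_measure; rewrite ?inE //.
      by apply: fin_bigcap_measurable => //; exact: finite_fset.
    by move=> w Ew i /=; rewrite !inE => /mapP[m _ ->]; exact: Ew.
  rewrite (indX J (fun=> A)) //; under eq_bigr do rewrite PA.
  by rewrite prodEFin big_const_seq count_predT sJ iter_mulr_1.
have PEfin : P E \is a fin_num by apply: fin_num_measure.
apply/eqP; rewrite eq_le measure_ge0 andbT -(fineK PEfin) lee_fin leNgt.
apply/negP => e0; have nq : `|q| < 1 by rewrite ger0_norm.
have /cvgrPdist_lt/(_ _ e0)[n _ /(_ n (leqnn n))] := cvg_expr nq.
rewrite /= sub0r normrN ger0_norm ?exprn_ge0 // ltNge => /negP; apply.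
by rewrite -lee_fin fineK.
Qed.
End Independence.

(** * Spacings of the Poisson process *)

Section Exponential.
Variables (R : realType) (rate : R).

Lemma exponential_prob_le0 : exponential_prob rate `]-oo, 0] = 0%E.
Proof.
rewrite /exponential_prob -integral_itv_bndo_bndc; last first.
  apply/measurable_EFinP; apply: measurable_funTS.
  exact: measurable_exponential_pdf.
apply: integral0_eq => x /=; rewrite in_itv /= => x0.
by rewrite lt0_exponential_pdf.
Qed.

Context d (T : measurableType d) (P : probability T R).
Variable X : {RV P >-> R}.
Hypothesis X_exp : forall A : set R, measurable A ->
  distribution P X A = exponential_prob rate A.

Lemma exponential_gt0 : {ae P, forall w, 0 < X w}.
Proof.
exists (X @^-1` `]-oo, 0]); split.
- by rewrite -[X in measurable X]setTI; apply: measurable_funPT.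
- by rewrite -[LHS]/(distribution P X _) X_exp // exponential_prob_le0.
- by move=> w /= /negP; rewrite in_itv /= leNgt.
Qed.

Lemma exponential_le1 :
  P (X @^-1` `]-oo, 1]) = (1 - expR (- rate))%:E.
Proof.
have mX (A : set R) : measurable A -> measurable (X @^-1` A).
  by move=> mA; rewrite -[X in measurable X]setTI; apply: measurable_funPT.
have -> : X @^-1` `]-oo, 1] = (X @^-1` `[0, 1]) `|` (X @^-1` `]-oo, 0]).
  apply/seteqP; split=> w /=; rewrite !in_itv /=.
    by move=> w1; have [w0|/ltW w0] := leP (X w) 0; [right|left; rewrite w1 w0].
  by case; lra.
rewrite measureU0; [|exact: mX|exact: mX|]; last first.
  by rewrite -[LHS]/(distribution P X _) X_exp // exponential_prob_le0.
rewrite -[LHS]/(distribution P X _) X_exp // exponential_prob_itv0c //.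
by rewrite mulr1.
Qed.

End Exponential.

(** Infinitely many spacings above 1 on each side carry [b] to both
infinities. *)
Lemma increasing_unbounded_spacings (R : realType) (b : int -> R) :
  (forall j, 0 < b j - b (j - 1)) ->
  (forall j, exists n : nat, 1 < b (j + n%:Z) - b (j + n%:Z - 1)) ->
  (forall j, exists n : nat, 1 < b (j - n%:Z) - b (j - n%:Z - 1)) ->
  increasing_unbounded b.
Proof.
move=> pos right_gap left_gap.
have binc : {homo b : m n / m < n}.
  have step j (n : nat) : b j < b (j + n.+1%:Z).
    elim: n => [|n IH]; first by have := pos (j + 1); rewrite addrK subr_gt0.
    apply: lt_trans IH _; have := pos (j + n.+2%:Z); rewrite subr_gt0.
    by have -> : j + n.+2%:Z - 1 = j + n.+1%:Z by lia.
  move=> m n mn; have -> : n = m + (absz (n - m - 1)%R).+1%:Z by lia.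
  exact: step.
have bmono : {mono b : m n / m <= n} by apply: le_mono.
split=> // M.
  have up (n : nat) : exists j, b 0 + n%:R <= b j.
    elim: n => [|n [j bj]]; first by exists 0; rewrite addr0.
    have [p gap] := right_gap (j + 1); exists (j + 1 + p%:Z).
    have : b j <= b (j + 1 + p%:Z - 1) by rewrite bmono; lia.
    by rewrite -natr1; lra.
  have [j bj] := up (Num.bound `|M - b 0|); exists j.
  have := archi_boundP (normr_ge0 (M - b 0)); have := ler_norm (M - b 0); lra.
have down (n : nat) : exists j, b j <= b 0 - n%:R.
  elim: n => [|n [j bj]]; first by exists 0; rewrite subr0.
  have [p gap] := left_gap j; exists (j - p%:Z - 1).
  have : b (j - p%:Z) <= b j by rewrite bmono; lia.
  by rewrite -natr1; lra.
have [j bj] := down (Num.bound `|b 0 - M|); exists j.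
have := archi_boundP (normr_ge0 (b 0 - M)); have := ler_norm (b 0 - M); lra.
Qed.

Lemma ae_forall_countable d (T : measurableType d) (R : realType)
    (P : probability T R) (I : countType) (Q : I -> T -> Prop) :
  (forall j, {ae P, forall w, Q j w}) -> {ae P, forall w, forall j, Q j w}.
Proof.
move=> aeQ.
pose Qn n w := if choice.unpickle n is Some j then Q j w else True.
have /ae_foralln : forall n, {ae P, forall w, Qn n w}.
  move=> n; rewrite /Qn; case: choice.unpickle => [j|]; first exact: aeQ.
  exact: aeW.
apply: filterS => w Qw j; have := Qw (choice.pickle j).
by rewrite /Qn choice.pickleK.
Qed.

Section PoissonPoints.
Context d (T : measurableType d) (R : realType) (P : probability T R).
Variables (rate : R) (B : int -> {RV P >-> R}).
Hypothesis hB : poisson_points rate B.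

(** The spacings beyond any index, on either side, cannot all be at most 1, as
each of them is so with the same probability [1 - expR (- rate)]. *)
Lemma poisson_points_increasing_unbounded :
  {ae P, forall w, increasing_unbounded (fun j => B j w)}.
Proof.
have [indS expS] := hB.
have gap (g : nat -> int) : injective g ->
    {ae P, forall w, exists n, 1 < B (g n) w - B (g n - 1) w}.
  move=> ginj.
  have q1 : 1 - expR (- rate) < 1 by rewrite ltrBlDr ltrDl expR_gt0.
  have := independent_leaves indS ginj (measurable_itv `]-oo, 1])
    (fun j => exponential_le1 (expS j)) q1.
  apply: filterS => w [n gn]; exists n; rewrite ltNge; apply/negP => gn1.
  by apply: gn; rewrite /= in_itv.
have pos := ae_forall_countable (fun j => exponential_gt0 (expS j)).
have rgap := ae_forall_countable (fun j => gap (fun n => j + n%:Z) _).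
have lgap := ae_forall_countable (fun j => gap (fun n => j - n%:Z) _).
have {}rgap := rgap (fun j => ltac:(by move=> m n /addrI[])).
have {}lgap := lgap (fun j => ltac:(by move=> m n /addrI/oppr_inj[])).
by apply: filterS3 pos rgap lgap => w; exact: increasing_unbounded_spacings.
Qed.

Lemma order_area_ae (k : nat) (i : int) :
  {ae P, forall w, order_area B k.+1 i w =
    (2^-1 * (B (i + k.+1%:Z) w - B (i + k.+1%:Z - 1) w) +
     2^-1 * (B (i - k%:Z) w - B (i - k%:Z - 1) w))%:E}.
Proof.
apply: filterS poisson_points_increasing_unbounded => w lw.
rewrite /order_area lebesgue_order_region //.
  by congr (_ * (_ - B _ w) + _ * (_ - B _ w))%:E; lia.
have mB := fun j => measurable_funPT (B j).
have mreg := measurable_order_region k.+1 i mB.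
have := measurable_xsection w mreg.
by congr measurable; apply/seteqP; split => x; rewrite /xsection /= inE.
Qed.

End PoissonPoints.

(** * Equality of laws *)

Section Law.
Context d (T : measurableType d) (R : realType) (P : probability T R).

Lemma ae_eq_pushforward d' (U : measurableType d') (f g : T -> U) :
  measurable_fun [set: T] f -> measurable_fun [set: T] g ->
  {ae P, forall w, f w = g w} ->
  forall A, measurable A -> pushforward P f A = pushforward P g A.
Proof.
move=> mf mg [N [mN PN fgN]] A mA; rewrite /pushforward.
have mfA : measurable (f @^-1` A).
  by rewrite -[X in measurable X]setTI; exact: mf.
have mgA : measurable (g @^-1` A).
  by rewrite -[X in measurable X]setTI; exact: mg.
rewrite -(measureU0 mfA mN PN) -(measureU0 mgA mN PN); congr (P _).
have fg w : ~ N w -> f w = g w by move=> nN; apply: contrapT => /fgN.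
apply/seteqP; split=> w; (have [Nw|/fg fgw] := EM (N w); first by right).
  by case=> [fw|]; [left; rewrite /= -fgw|right].
by case=> [gw|]; [left; rewrite /= fgw|right].
Qed.

(** The factorisation over rectangles characterises the product measure, so the
joint law does not depend on the space on which the pair is defined. *)
Lemma pair_law (mu : probability R R) (X Y : {RV P >-> R}) :
  (forall A C : set R, measurable A -> measurable C ->
    P ((X @^-1` A) `&` (Y @^-1` C)) = (mu A * mu C)%E) ->
  forall E : set (R * R), measurable E ->
    P [set w | E (X w, Y w)] = (mu \x mu)%E E.
Proof.
move=> XY E mE.
have mXY : measurable_fun [set: T] (fun w => (X w, Y w)).
  by apply: measurable_fun_pair.
pose Z : {mfun T >-> (R * R)%type} := mfun_Sub (mem_set mXY).
by rewrite (@product_measure_unique _ _ _ _ _ mu mu (distribution P Z)).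
Qed.

End Law.

Theorem lemma2 (R : realType) (lambdaB : R) (hlambda : 0 < lambdaB)
    (k : nat) (hk : (1 <= k)%N)
    (d : measure_display) (T : measurableType d) (P : probability T R)
    (B : int -> {RV P >-> R}) (hB : poisson_points lambdaB B)
    (i : int)
    (d' : measure_display) (T' : measurableType d') (P' : probability T' R)
    (D1 D2 : {RV P' >-> R})
    (hD : iid_exponential lambdaB (fun b : bool => if b then D1 else D2)) :
  eq_in_distribution P P' (order_area B k i)
    (fun w => (2^-1 * D1 w + 2^-1 * D2 w)%:E).
Proof.
case: k hk => // k _; have [indS expS] := hB; have [indD expD] := hD.
pose h (p : R * R) := (2^-1 * p.1 + 2^-1 * p.2)%:E.
have mh : measurable_fun [set: R * R] h.
  by apply/measurable_EFinP; apply: measurable_funD; apply: measurable_funM.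
(* The spacings are [S (i + k + 1)] and [S (i - k)], as [k] is now the
   predecessor of the order. *)
pose S j : {RV P >-> R} := B j \- B (j - 1).
have mpair d0 (T0 : measurableType d0) (X Y : {mfun T0 >-> R}) :
    measurable_fun [set: T0] (fun w => h (X w, Y w)).
  by apply: measurableT_comp => //; apply: measurable_fun_pair.
split; [exact: measurable_order_area|exact: mpair|move=> A mA].
rewrite (ae_eq_pushforward (measurable_order_area B k.+1 i)
  (mpair _ _ (S (i + k.+1%:Z)) (S (i - k%:Z))) (order_area_ae hB k i) mA).
have mhA : measurable (h @^-1` A) by rewrite -[X in measurable X]setTI; exact: mh.
pose mu := distribution P' D1.
have muE C : measurable C -> mu C = exponential_prob lambdaB C := expD true C.
transitivity ((mu \x mu)%E (h @^-1` A)).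
  apply: (pair_law (mu := mu) (X := S _) (Y := S _)) => // C1 C2 mC1 mC2.
  rewrite (independent_pair indS) //; last lia.
  by congr (_ * _)%E; [exact: etrans (expS _ _ mC1) (esym (muE _ mC1))
    |exact: etrans (expS _ _ mC2) (esym (muE _ mC2))].
apply/esym; apply: (pair_law (mu := mu)) => // C1 C2 mC1 mC2.
rewrite (independent_pair (i := true) (j := false) indD) //.
by congr (_ * _)%E; exact: etrans (expD false _ mC2) (esym (muE _ mC2)).
Qed.
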